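(* Let $\beta: I\to M\subset G^3$ be a unit-speed curve on a surface $M$ in the Galilean space $G^3$ which is an asymptotic curve ($\kappa_n\equiv0$) and a circular helix (its curvature $\kappa$ and torsion $\tau$ are both positive constants). Then there are real constants $c\ne0$, $c_1,c_2,c_3,c_4,c_5,e$ such that for all $x\in I$ $$\beta(x)=\Big(x,\ -\frac{e}{c^2}\sin(cx+c_1)+c_2x+c_3,\ -\frac{e}{c^2}\cos(cx+c_1)+c_4x+c_5\Big).$$
   Context: The Galilean space $G^3$ is $\mathbb R^3$ with the scalar product $\mathbf v\cdot_G\mathbf w=v_1w_1$ if $v_1\ne0$ or $w_1\neq 0$, and $\mathbf v\cdot_G\mathbf w=v_2w_2+v_3w_3$ if $v_1=w_1=0$; the norm is $\|\mathbf v\|_G=\sqrt{|\mathbf v\cdot_G\mathbf v|}$ and the cross product is $\mathbf v\times_G\mathbf w=(0,\,v_3w_1-v_1w_3,\,v_1w_2-v_2w_1)$. A vector is isotropic if its first component is $0$. All objects are smooth and $I\subset\mathbb R$ is an open interval. $M$ is an oriented surface with local parametrizations $\phi(u,v)$ such that the first components of $\phi_u,\phi_v$ are not both zero; its unit normal is the isotropic vector field $\mathbf n=\pm\,\phi_u\times_G\phi_v/\|\phi_u\times_G\phi_v\|_G$ (sign fixed by the orientation). A unit-speed curve (parametrized by arc length) is one of the form $\beta(x)=(x,y(x),z(x))$, $x\in I$. Its curvature is $\kappa=\|\beta''\|_G$, assumed positive, and its torsion is $\tau=\det(\beta',\beta'',\beta''')/\kappa^2$. Its Darboux frame with respect to $M$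 is $\{\mathbf T,\mathbf Q,\mathbf n\}$ with $\mathbf T=\beta'$, $\mathbf n$ the unit normal of $M$ along $\beta$, and $\mathbf Q=\mathbf T\times_G\mathbf n$. The functions $\kappa_g=\mathbf T'\cdot_G\mathbf Q$, $\kappa_n=\mathbf T'\cdot_G\mathbf n$, $\tau_g=\mathbf Q'\cdot_G\mathbf n$ are the geodesic curvature, normal curvature and geodesic torsion. *)

(* Defs.v *)
(* Uses the Stdlib reals and Coquelicot. *)
From Stdlib Require Import Reals.
From Coquelicot Require Import Coquelicot.
Open Scope R_scope.

Definition vec : Type := (R * R * R)%type.

Definition vx (v : vec) : R := fst (fst v).
Definition vy (v : vec) : R := snd (fst v).
Definition vz (v : vec) : R := snd v.

Definition gdot (v w : vec) : R :=
  if Req_EM_T (vx v) 0 then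
    if Req_EM_T (vx w) 0 then vy v * vy w + vz v * vz w
    else vx v * vx w
  else vx v * vx w.

Definition gnorm (v : vec) : R := sqrt (Rabs (gdot v v)).

Definition gcross (v w : vec) : vec :=
  (0, vz v * vx w - vx v * vz w, vx v * vy w - vy v * vx w).

Definition det3 (u v w : vec) : R :=
  vx u * (vy v * vz w - vz v * vy w)
  - vy u * (vx v * vz w - vz v * vx w)
  + vz u * (vx v * vy w - vy v * vx w).

Definition Rbar_interval (a b : Rbar) (x : R) : Prop :=
  Rbar_lt a x /\ Rbar_lt x b.

(* Meaningful only where all three components are differentiable. *)
Definition vderive (f : R -> vec) (x : R) : vec :=
  (Derive (fun t => vx (f t)) x,
   Derive (fun t => vy (f t)) x,
   Derive (fun t => vz (f t)) x).

Definition smooth_on (I : R -> Prop) (f : R -> vec) : Prop :=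
  forall (n : nat) (x : R), I x ->
    ex_derive_n (fun t => vx (f t)) n x /\
    ex_derive_n (fun t => vy (f t)) n x /\
    ex_derive_n (fun t => vz (f t)) n x.

Definition partial_u (phi : R -> R -> vec) (u v : R) : vec :=
  vderive (fun s => phi s v) u.

Definition partial_v (phi : R -> R -> vec) (u v : R) : vec :=
  vderive (fun s => phi u s) v.

(* On an open set, [ex_diff_n _ n] for every [n] says that all iterated
   partial derivatives exist and are (jointly) continuous. *)
Definition smooth2_on (U : R * R -> Prop) (phi : R -> R -> vec) : Prop :=
  forall (n : nat) (u v : R), U (u, v) ->
    ex_diff_n (fun s t => vx (phi s t)) n u v /\
    ex_diff_n (fun s t => vy (phi s t)) n u v /\
    ex_diff_n (fun s t => vz (phi s t)) n u v.

Definition image2 (U : R * R -> Prop) (phi : R -> R -> vec) (q : vec) : Prop :=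
  exists u v : R, U (u, v) /\ q = phi u v.

(* [phi] is a regular parametrization of the relatively open piece [phi(U)] of
   [M], and a homeomorphism onto it. *)
Record local_parametrization (M : vec -> Prop) (U : R * R -> Prop)
    (phi : R -> R -> vec) : Prop := {
  lp_open : open U;
  lp_smooth : smooth2_on U phi;
  lp_regular : forall u v : R, U (u, v) ->
    forall a b : R,
      plus (scal a (partial_u phi u v)) (scal b (partial_v phi u v)) = zero ->
      a = 0 /\ b = 0;
  lp_admissible : forall u v : R, U (u, v) ->
    ~ (vx (partial_u phi u v) = 0 /\ vx (partial_v phi u v) = 0);
  lp_image : exists V : vec -> Prop, open V /\
    forall q : vec, image2 U phi q <-> (V q /\ M q);
  lp_inverse : exists psi : vec -> R * R,
    (forall u v : R, U (u, v) -> psi (phi u v) = (u, v)) /\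
    (forall q : vec, image2 U phi q ->
       filterlim psi (within M (locally q)) (locally (psi q)))
}.

Definition unit_cross (phi : R -> R -> vec) (u v : R) : vec :=
  let w := gcross (partial_u phi u v) (partial_v phi u v) in
  scal (/ gnorm w) w.

(* The orientation is the choice of the unit normal field: it agrees, up to a
   sign that is constant on each chart of some atlas, with the normalized
   Galilean cross product.  The values of [normal] outside of [carrier] are
   irrelevant. *)
Record oriented_surface : Type := {
  carrier : vec -> Prop;
  normal : vec -> vec;
  surface_charts : forall p : vec, carrier p ->
    exists (U : R * R -> Prop) (phi : R -> R -> vec) (eps : R),
      local_parametrization carrier U phi /\
      image2 U phi p /\
      (eps = 1 \/ eps = -1) /\
      forall u v : R, U (u, v) ->
        normal (phi u v) = scal eps (unit_cross phi u v)
}.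

Definition unit_speed_on (I : R -> Prop) (beta : R -> vec) : Prop :=
  smooth_on I beta /\ forall x : R, I x -> vx (beta x) = x.

Definition lies_on (I : R -> Prop) (M : oriented_surface) (beta : R -> vec)
    : Prop :=
  forall x : R, I x -> carrier M (beta x).

Definition curvature (beta : R -> vec) (x : R) : R :=
  gnorm (vderive (vderive beta) x).

Definition torsion (beta : R -> vec) (x : R) : R :=
  det3 (vderive beta x) (vderive (vderive beta) x)
       (vderive (vderive (vderive beta)) x)
  / (curvature beta x) ^ 2.

Definition darboux_T (beta : R -> vec) : R -> vec := vderive beta.

Definition darboux_n (M : oriented_surface) (beta : R -> vec) (x : R) : vec :=
  normal M (beta x).

Definition normal_curvature (M : oriented_surface) (beta : R -> vec) (x : R)
    : R :=
  gdot (vderive (darboux_T beta) x) (darboux_n M beta x).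

Definition asymptotic_on (I : R -> Prop) (M : oriented_surface)
    (beta : R -> vec) : Prop :=
  forall x : R, I x -> normal_curvature M beta x = 0.

Definition circular_helix_on (I : R -> Prop) (beta : R -> vec) : Prop :=
  exists kappa tau : R, 0 < kappa /\ 0 < tau /\
    forall x : R, I x -> curvature beta x = kappa /\ torsion beta x = tau.

(* Main.v *)
(* Along [beta = (x, y, z)] the curvature is the Euclidean length of
   [(y'', z'')] and the torsion is [(y'' z''' - z'' y''') / kappa^2].  Constancy
   of [kappa] adds [y'' y''' + z'' z''' = 0], so [y''' = - tau z''] and
   [z''' = tau y'']: the second derivatives rotate uniformly with angular speed
   [c = - tau], i.e. [y'' = e sin (c x + c1)] and [z'' = e cos (c x + c1)].
   Moreover [y + y'' / c^2] and [z + z'' / c^2] have vanishing second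
   derivative, hence are affine. *)
Require Import Defs.
From Stdlib Require Import Reals Lra Classical.
From Coquelicot Require Import Coquelicot.
Open Scope R_scope.

Lemma Rbar_interval_locally (a b : Rbar) (x : R) :
  Rbar_interval a b x -> locally x (Rbar_interval a b).
Proof.
  intros Hx.
  apply (open_and (fun y : R => Rbar_lt a y) (fun y : R => Rbar_lt y b));
    [apply open_Rbar_gt | apply open_Rbar_lt | exact Hx].
Qed.

Lemma Rbar_interval_convex (a b : Rbar) (x y t : R) :
  Rbar_interval a b x -> Rbar_interval a b y ->
  Rmin x y <= t <= Rmax x y -> Rbar_interval a b t.
Proof.
  intros [Hax Hxb] [Hay Hyb] [Hl Hr]; split.
  - apply Rbar_lt_le_trans with (Rmin x y); [|exact Hl].
    unfold Rmin; destruct (Rle_dec x y); assumption.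
  - apply Rbar_le_lt_trans with (Rmax x y); [exact Hr|].
    unfold Rmax; destruct (Rle_dec x y); assumption.
Qed.

Lemma is_derive_0_constant (a b : Rbar) (f : R -> R) :
  (forall x, Rbar_interval a b x -> is_derive f x 0) ->
  forall x y, Rbar_interval a b x -> Rbar_interval a b y -> f x = f y.
Proof.
  intros Hf x y Hx Hy.
  assert (Hd : forall t, Rmin x y <= t <= Rmax x y -> is_derive f t 0).
  { intros t Ht; apply Hf, (Rbar_interval_convex a b x y); assumption. }
  destruct (MVT_gen f x y (fun _ => 0)) as [t [_ Ht]].
  - intros t Ht; apply Hd; lra.
  - intros t Ht; apply derivable_continuous_pt.
    exists 0; apply is_derive_Reals, Hd, Ht.
  - lra.
Qed.

Lemma second_derive_0_affine (a b : Rbar) (f g : R -> R) (x0 : R) :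
  Rbar_interval a b x0 ->
  (forall x, Rbar_interval a b x -> is_derive f x (g x)) ->
  (forall x, Rbar_interval a b x -> is_derive g x 0) ->
  exists m n : R, forall x, Rbar_interval a b x -> f x = m * x + n.
Proof.
  intros H0 Hf Hg.
  (* The line is the tangent to [f] at [x0]: [g] is constant, so subtracting its linear part from
     [f] leaves derivative 0. *)
  exists (g x0), (f x0 - g x0 * x0); intros x Hx.
  assert (E : f x - g x0 * x = f x0 - g x0 * x0).
  { apply (is_derive_0_constant a b (fun t => f t - g x0 * t)); auto.
    intros t Ht.
    replace 0 with (g t - g x0 * 1)
      by (rewrite (is_derive_0_constant a b g Hg t x0 Ht H0); ring).
    apply @is_derive_minus; [auto|].
    apply is_derive_scal, @is_derive_id. }
  lra.
Qed.

(** Turns the initial data of the rotation equation into an amplitude and a phase. The phase is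
    [acos (v / e)] up to sign, with [e] the Euclidean length; at the origin any phase works. *)
Lemma polar_form (u v : R) :
  exists e t : R, u = e * sin t /\ v = e * cos t.
Proof.
  set (e := sqrt (u ^ 2 + v ^ 2)).
  assert (Hsq : e * e = u ^ 2 + v ^ 2) by (apply sqrt_sqrt; nra).
  assert (He : 0 <= e) by apply sqrt_pos.
  destruct (Req_dec e 0) as [E | E].
  { exists 0, 0; split; nra. }
  assert (Hinv : (v / e) * e = v) by (field; exact E).
  assert (Hve : - e <= v <= e) by (split; nra).
  assert (Hb : -1 <= v / e <= 1).
  { split; apply (Rmult_le_reg_r e); lra. }
  assert (Hc : cos (acos (v / e)) = v / e) by (apply cos_acos; exact Hb).
  assert (Hs : 0 <= sin (acos (v / e))).
  { destruct (acos_bound (v / e)); apply sin_ge_0; assumption. }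
  assert (Hp := sin2_cos2 (acos (v / e))).
  unfold Rsqr in Hp; rewrite Hc in Hp.
  set (s := sin (acos (v / e))) in *.
  (* [e * s] and [u] have equal squares. If they are opposite, negating the angle corrects the sine
     and keeps the cosine. *)
  assert (Hes : (e * s - u) * (e * s + u) = 0).
  { replace ((e * s - u) * (e * s + u))
      with (e * e * (s * s + v / e * (v / e)) - (v / e * e) ^ 2 - u ^ 2)
      by ring.
    rewrite Hp, Hinv; lra. }
  apply Rmult_integral in Hes; destruct Hes as [H | H].
  - exists e, (acos (v / e)); rewrite Hc; fold s; split; lra.
  - exists e, (- acos (v / e)); rewrite sin_neg, cos_neg, Hc; fold s.
    split; lra.
Qed.

(** Turning [(p, q)] back by the angle [c * x] gives the pair [(A, B)], whose derivative vanishes.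
    The polar form of its constant value supplies [e] and [c1]. *)
Lemma rotation_ode_solution (a b : Rbar) (p q : R -> R) (c x0 : R) :
  Rbar_interval a b x0 ->
  (forall x, Rbar_interval a b x -> is_derive p x (c * q x)) ->
  (forall x, Rbar_interval a b x -> is_derive q x (- c * p x)) ->
  exists e c1 : R, forall x, Rbar_interval a b x ->
    p x = e * sin (c * x + c1) /\ q x = e * cos (c * x + c1).
Proof.
  intros H0 Hp Hq.
  set (A := fun x => p x * cos (c * x) - q x * sin (c * x)).
  set (B := fun x => p x * sin (c * x) + q x * cos (c * x)).
  destruct (polar_form (A x0) (B x0)) as [e [c1 [HA HB]]].
  exists e, c1; intros x Hx.
  assert (EA : A x = A x0).
  { apply (is_derive_0_constant a b A); auto.
    intros t Ht; specialize (Hp t Ht); specialize (Hq t Ht); unfold A.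
    auto_derive; [split; [eexists; exact Hp|split; [eexists; exact Hq|exact I]]|].
    change (Derive (fun x => p x) t) with (Derive p t).
    change (Derive (fun x => q x) t) with (Derive q t).
    rewrite (is_derive_unique _ _ _ Hp), (is_derive_unique _ _ _ Hq); ring. }
  assert (EB : B x = B x0).
  { apply (is_derive_0_constant a b B); auto.
    intros t Ht; specialize (Hp t Ht); specialize (Hq t Ht); unfold B.
    auto_derive; [split; [eexists; exact Hp|split; [eexists; exact Hq|exact I]]|].
    change (Derive (fun x => p x) t) with (Derive p t).
    change (Derive (fun x => q x) t) with (Derive q t).
    rewrite (is_derive_unique _ _ _ Hp), (is_derive_unique _ _ _ Hq); ring. }
  rewrite HA in EA; rewrite HB in EB; unfold A in EA; unfold B in EB.
  assert (Hcs := sin2_cos2 (c * x)); unfold Rsqr in Hcs.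
  rewrite sin_plus, cos_plus.
  set (C := cos (c * x)) in *; set (S := sin (c * x)) in *.
  split.
  (* Undoes the rotation: [p = A C + B S] and, below, [q = B C - A S]; the addition formulas then
     apply. *)
  - replace (p x) with ((p x * C - q x * S) * C + (p x * S + q x * C) * S).
    + rewrite EA, EB; ring.
    + replace (p x) with (p x * (S * S + C * C)) at 3 by (rewrite Hcs; ring).
      ring.
  - replace (q x) with ((p x * S + q x * C) * C - (p x * C - q x * S) * S).
    + rewrite EA, EB; ring.
    + replace (q x) with (q x * (S * S + C * C)) at 3 by (rewrite Hcs; ring).
      ring.
Qed.

(** The two first-order equations give [p'' = - c ^ 2 * p], so [y0 + p / c ^ 2] has zero second
    derivative. The free factor [k] lets one lemma serve both coordinates, whose equations differ in
    sign. *)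
Lemma affine_correction (a b : Rbar) (y0 y1 p q : R -> R) (c k x0 : R) :
  Rbar_interval a b x0 -> c <> 0 -> k <> 0 ->
  (forall x, Rbar_interval a b x -> is_derive y0 x (y1 x)) ->
  (forall x, Rbar_interval a b x -> is_derive y1 x (p x)) ->
  (forall x, Rbar_interval a b x -> is_derive p x (k * q x)) ->
  (forall x, Rbar_interval a b x -> is_derive q x (- (c ^ 2 / k) * p x)) ->
  exists m n : R, forall x, Rbar_interval a b x ->
    y0 x = - (p x / c ^ 2) + m * x + n.
Proof.
  intros H0 Hc Hk Hy0 Hy1 Hp Hq.
  destruct (second_derive_0_affine a b (fun x => y0 x + / c ^ 2 * p x)
              (fun x => y1 x + / c ^ 2 * (k * q x)) x0 H0) as [m [n E]].
  - intros x Hx; apply @is_derive_plus; [auto|].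
    apply is_derive_scal; auto.
  - intros x Hx.
    replace 0 with (p x + / c ^ 2 * (k * (- (c ^ 2 / k) * p x)))
      by (field; auto).
    apply @is_derive_plus; [auto|].
    apply is_derive_scal, is_derive_scal; auto.
  - exists m, n; intros x Hx; specialize (E x Hx); cbv beta in E.
    rewrite Rplus_assoc, <- E; field; exact Hc.
Qed.

Lemma is_derive_Derive_n (f : R -> R) (n : nat) (x : R) :
  ex_derive_n f (S n) x -> is_derive (Derive_n f n) x (Derive_n f (S n) x).
Proof. intros H; apply Derive_correct, H. Qed.

(** The first coordinate is the identity only on the interval; since the interval is open, each
    equality holds near every point and can be differentiated again. *)
Lemma unit_speed_vx_derivatives (a b : Rbar) (beta : R -> vec) (x : R) :
  unit_speed_on (Rbar_interval a b) beta -> Rbar_interval a b x ->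
  vx (vderive beta x) = 1 /\
  vx (vderive (vderive beta) x) = 0 /\
  vx (vderive (vderive (vderive beta)) x) = 0.
Proof.
  intros [_ Hv].
  set (X := fun t => vx (beta t)).
  assert (H1 : forall t, Rbar_interval a b t -> Derive X t = 1).
  { intros t Ht; rewrite (Derive_ext_loc X (fun s => s)); [apply Derive_id|].
    apply (filter_imp (Rbar_interval a b));
      [exact Hv | apply Rbar_interval_locally, Ht]. }
  assert (H2 : forall t, Rbar_interval a b t -> Derive (Derive X) t = 0).
  { intros t Ht; rewrite (Derive_ext_loc _ (fun _ => 1)); [apply Derive_const|].
    apply (filter_imp (Rbar_interval a b));
      [exact H1 | apply Rbar_interval_locally, Ht]. }
  intros Hx; split; [|split].
  - exact (H1 x Hx).
  - exact (H2 x Hx).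
  - change (Derive (Derive (Derive X)) x = 0).
    rewrite (Derive_ext_loc _ (fun _ => 0)); [apply Derive_const|].
    apply (filter_imp (Rbar_interval a b));
      [exact H2 | apply Rbar_interval_locally, Hx].
Qed.

(** Squaring removes the root, so constancy of the curvature becomes a polynomial identity that is
    easy to differentiate. *)
Lemma gnorm_isotropic_sqr (v : vec) :
  vx v = 0 -> gnorm v * gnorm v = vy v * vy v + vz v * vz v.
Proof.
  intros H; unfold gnorm, gdot.
  destruct (Req_EM_T (vx v) 0) as [_|N]; [|contradiction].
  rewrite Rabs_pos_eq by nra; apply sqrt_sqrt; nra.
Qed.

Theorem corollary4p8 (a b : Rbar) (M : oriented_surface) (beta : R -> vec)
    (beta_unit_speed : unit_speed_on (Rbar_interval a b) beta)
    (beta_on_M : lies_on (Rbar_interval a b) M beta)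
    (beta_asymptotic : asymptotic_on (Rbar_interval a b) M beta)
    (beta_helix : circular_helix_on (Rbar_interval a b) beta) :
  exists c c1 c2 c3 c4 c5 e : R,
    c <> 0 /\
    forall x : R, Rbar_interval a b x ->
      beta x =
        (x,
         - (e / c ^ 2) * sin (c * x + c1) + c2 * x + c3,
         - (e / c ^ 2) * cos (c * x + c1) + c4 * x + c5).
Proof.
  destruct (classic (exists x0, Rbar_interval a b x0)) as [[x0 H0] | Hempty].
  (* On an empty interval there is no base point, and any constants with [c <> 0] do. *)
  2:{ exists 1, 0, 0, 0, 0, 0, 0; split; [lra|].
      intros x Hx; elim Hempty; exists x; exact Hx. }
  destruct beta_helix as [kappa [tau [Hk [Ht Hkt]]]].
  set (y := Derive_n (fun t => vy (beta t))).
  set (z := Derive_n (fun t => vz (beta t))).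
  assert (Hy : forall n x, Rbar_interval a b x -> is_derive (y n) x (y (S n) x)).
  { intros n x Hx; apply is_derive_Derive_n, (proj1 beta_unit_speed (S n) x Hx). }
  assert (Hz : forall n x, Rbar_interval a b x -> is_derive (z n) x (z (S n) x)).
  { intros n x Hx; apply is_derive_Derive_n, (proj1 beta_unit_speed (S n) x Hx). }
  assert (Hcurv : forall x, Rbar_interval a b x ->
            y 2%nat x * y 2%nat x + z 2%nat x * z 2%nat x = kappa * kappa).
  { intros x Hx; destruct (Hkt x Hx) as [E _]; rewrite <- E; symmetry.
    apply (gnorm_isotropic_sqr (vderive (vderive beta) x)).
    apply (unit_speed_vx_derivatives a b beta x beta_unit_speed Hx). }
  assert (Htors : forall x, Rbar_interval a b x ->
            y 2%nat x * z 3%nat x - z 2%nat x * y 3%nat x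
            = tau * (kappa * kappa)).
  { intros x Hx; destruct (Hkt x Hx) as [E F].
    destruct (unit_speed_vx_derivatives a b beta x beta_unit_speed Hx)
      as [E1 [E2 E3]].
    (* The first components 1, 0, 0 reduce the determinant to its lower 2 by 2 minor. *)
    unfold torsion, det3 in F; rewrite E, E1, E2, E3 in F.
    rewrite <- F.
    change (vy (vderive (vderive beta) x)) with (y 2%nat x).
    change (vz (vderive (vderive beta) x)) with (z 2%nat x).
    change (vy (vderive (vderive (vderive beta)) x)) with (y 3%nat x).
    change (vz (vderive (vderive (vderive beta)) x)) with (z 3%nat x).
    field; lra. }
  assert (Horth : forall x, Rbar_interval a b x ->
            y 2%nat x * y 3%nat x + z 2%nat x * z 3%nat x = 0).
  { intros x Hx.
    assert (D : is_derive
        (fun t => y 2%nat t * y 2%nat t + z 2%nat t * z 2%nat t) x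
        ((y 3%nat x * y 2%nat x + y 2%nat x * y 3%nat x)
         + (z 3%nat x * z 2%nat x + z 2%nat x * z 3%nat x))).
    { apply @is_derive_plus; apply @is_derive_mult; auto using Rmult_comm. }
    apply is_derive_unique in D.
    rewrite (Derive_ext_loc _ (fun _ => kappa * kappa)), Derive_const in D.
    - lra.
    - apply (filter_imp (Rbar_interval a b));
        [exact Hcurv | apply Rbar_interval_locally, Hx]. }
  assert (Hkk : kappa * kappa <> 0) by nra.
  assert (Hp : forall x, Rbar_interval a b x ->
            is_derive (y 2%nat) x (- tau * z 2%nat x)).
  { intros x Hx; specialize (Hy 2%nat x Hx).
    replace (- tau * z 2%nat x) with (y 3%nat x); [exact Hy|].
    specialize (Hcurv x Hx); specialize (Htors x Hx); specialize (Horth x Hx).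
    apply (Rmult_eq_reg_l (kappa * kappa)); [|exact Hkk].
    transitivity (- z 2%nat x * (tau * (kappa * kappa))); [|ring].
    rewrite <- Htors, <- Hcurv.
    (* Cramer's rule: [Horth] and [Htors] form a linear system in the third derivatives, with
       determinant [kappa * kappa]. *)
    replace ((y 2%nat x * y 2%nat x + z 2%nat x * z 2%nat x) * y 3%nat x)
      with (y 2%nat x * (y 2%nat x * y 3%nat x + z 2%nat x * z 3%nat x)
            - z 2%nat x * (y 2%nat x * z 3%nat x - z 2%nat x * y 3%nat x))
      by ring.
    rewrite Horth; ring. }
  assert (Hq : forall x, Rbar_interval a b x ->
            is_derive (z 2%nat) x (- - tau * y 2%nat x)).
  { intros x Hx; specialize (Hz 2%nat x Hx).
    replace (- - tau * y 2%nat x) with (z 3%nat x); [exact Hz|].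
    specialize (Hcurv x Hx); specialize (Htors x Hx); specialize (Horth x Hx).
    apply (Rmult_eq_reg_l (kappa * kappa)); [|exact Hkk].
    transitivity (y 2%nat x * (tau * (kappa * kappa))); [|ring].
    rewrite <- Htors, <- Hcurv.
    replace ((y 2%nat x * y 2%nat x + z 2%nat x * z 2%nat x) * z 3%nat x)
      with (z 2%nat x * (y 2%nat x * y 3%nat x + z 2%nat x * z 3%nat x)
            + y 2%nat x * (y 2%nat x * z 3%nat x - z 2%nat x * y 3%nat x))
      by ring.
    rewrite Horth; ring. }
  destruct (rotation_ode_solution a b _ _ _ x0 H0 Hp Hq) as [e [c1 Epq]].
  (* With [c = - tau], the factor [k] is [- tau] for [y] and [- - tau] for [z]; in each case
     [- (c ^ 2 / k)] is the coefficient of the other equation. *)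
  destruct (affine_correction a b (y 0%nat) (y 1%nat) (y 2%nat) (z 2%nat)
              (- tau) (- tau) x0) as [c2 [c3 Ey]]; auto; try lra.
  { intros x Hx; replace (- ((- tau) ^ 2 / - tau)) with (- - tau)
      by (field; lra); auto. }
  destruct (affine_correction a b (z 0%nat) (z 1%nat) (z 2%nat) (y 2%nat)
              (- tau) (- - tau) x0) as [c4 [c5 Ez]]; auto; try lra.
  { intros x Hx; replace (- ((- tau) ^ 2 / - - tau)) with (- tau)
      by (field; lra); auto. }
  exists (- tau), c1, c2, c3, c4, c5, e; split; [lra|].
  intros x Hx.
  assert (Ex := proj2 beta_unit_speed x Hx).
  specialize (Ey x Hx); specialize (Ez x Hx).
  (* Both coordinates share [e] and [c1], because their second derivatives come from one
     rotation. *)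
  destruct (Epq x Hx) as [Ep Eq]; rewrite Ep in Ey; rewrite Eq in Ez.
  change (y 0%nat x) with (vy (beta x)) in Ey.
  change (z 0%nat x) with (vz (beta x)) in Ez.
  destruct (beta x) as [[bx by_] bz]; unfold vx, vy, vz in *; simpl fst in *;
    simpl snd in *.
  rewrite Ex, Ey, Ez; f_equal; [f_equal|]; field; lra.
Qed.
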